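(* Let $\mathsf{L}$, $\mathsf{H}$ and $\mathsf{K}$ be simplicial complexes. Then $$\mathrm{C}(\mathsf{L};\mathsf{K})\leq \mathrm{C}(\mathsf{L};\mathsf{H})\cdot \mathrm{C}(\mathsf{H};\mathsf{K})\quad\text{and}\quad \mathrm{IC}(\mathsf{L};\mathsf{K})\leq \mathrm{IC}(\mathsf{L};\mathsf{H})\cdot \mathrm{IC}(\mathsf{H};\mathsf{K}).$$
   Context: A simplicial complex is an abstract simplicial complex: a set $\mathsf{K}$ of subsets (simplices) of a vertex set $V(\mathsf{K})=\bigcup\mathsf{K}$ such that $F\in\mathsf{K}$ and $G\subseteq F$ imply $G\in\mathsf{K}$. A facet is a simplex that is maximal with respect to inclusion; a facet is non-unitary if it has at least two vertices. A subcomplex of $\mathsf{K}$ is a simplicial complex contained in $\mathsf{K}$. The union of simplicial complexes is the union of their vertex sets and of their sets of simplices. A simplicial map $f:\mathsf{L}\to\mathsf{K}$ is a map $f:V(\mathsf{L})\to V(\mathsf{K})$ such that $f(F)\in\mathsf{K}$ whenever $F\in\mathsf{L}$; it is injective if it is injective on vertices. A facet simplicial map is a simplicial map $f:\mathsf{L}\to\mathsf{K}$ such that $f(F)$ is a non-unitary facet of $\mathsf{K}$ whenever $F$ is a non-unitary facet of $\mathsf{L}$. The facet-complexity $\mathrm{C}(\mathsf{L};\mathsf{K})$ is the least positive integer $k$ such that there exist subcomplexes $\mathsf{L}_1,\ldots,\mathsf{L}_k$ of $\mathsf{L}$ with $\mathsf{L}=\mathsf{L}_1\cup\cdots\cup\mathsf{L}_k$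 and, for each $i$, a facet simplicial map $f_i:\mathsf{L}_i\to\mathsf{K}$; it is $\infty$ if no such $k$ exists. The injective facet-complexity $\mathrm{IC}(\mathsf{L};\mathsf{K})$ is defined in the same way, requiring each $f_i$ to be an injective facet simplicial map. *)

(* Defs.v *)
From HB Require Import structures.
From mathcomp Require Import all_boot all_order all_algebra.
From mathcomp Require Import boolp classical_sets constructive_ereal.

Set Implicit Arguments.
Unset Strict Implicit.
Unset Printing Implicit Defensive.

Local Open Scope classical_set_scope.

(* No finiteness is assumed, neither of the complex nor of its simplices; the
   empty complex (no simplex at all) is allowed. *)
Record complex (T : Type) := Complex {
  simplices :> set (set T);
  simplices_down : forall F G : set T, simplices F -> G `<=` F -> simplices G }.

Definition vertices (T : Type) (K : complex T) : set T :=
  [set x | exists2 F, simplices K F & F x].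

Definition facet (T : Type) (K : complex T) (F : set T) : Prop :=
  simplices K F /\ forall G, simplices K G -> F `<=` G -> G = F.

Definition nonunitary_facet (T : Type) (K : complex T) (F : set T) : Prop :=
  facet K F /\ exists x y, [/\ F x, F y & x <> y].

Definition subcomplex (T : Type) (L K : complex T) : Prop :=
  simplices L `<=` simplices K.

(* Equality of the vertex sets follows, see [vertices_union]. *)
Definition is_union (T I : Type) (L : complex T) (Ls : I -> complex T) : Prop :=
  simplices L = \bigcup_i simplices (Ls i).

Lemma vertices_union (T I : Type) (L : complex T) (Ls : I -> complex T) :
  is_union L Ls -> vertices L = \bigcup_i vertices (Ls i).
Proof.
move=> LE; apply/seteqP; split=> [x [F]|x [i _ [F LiF Fx]]].
  by rewrite LE => -[i _ LiF] Fx; exists i => //; exists F.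
by exists F => //; rewrite LE; exists i.
Qed.

Section Maps.
Variables (S T : Type) (L : complex S) (K : complex T).

(* Vertex maps are defined on the vertices of L only, and not on the whole
   ambient type S: the two differ when T is empty. *)
Definition simplex_image (f : vertices L -> vertices K) (F : set S) : set T :=
  [set val (f x) | x in [set x : vertices L | F (val x)]].

Definition simplicial_map (f : vertices L -> vertices K) : Prop :=
  forall F, simplices L F -> simplices K (simplex_image f F).

Definition facet_simplicial_map (f : vertices L -> vertices K) : Prop :=
  simplicial_map f /\
  forall F, nonunitary_facet L F -> nonunitary_facet K (simplex_image f F).

Definition injective_facet_simplicial_map
    (f : vertices L -> vertices K) : Prop :=
  facet_simplicial_map f /\ injective f.

End Maps.

Definition least_positive (P : nat -> Prop) : \bar int :=
  match pselect (exists k, `[< (0 < k)%N /\ P k >]) with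
  | left exP => ((ex_minn exP)%:Z)%:E
  | right _ => +oo%E
  end.

Definition facet_complexity (S T : Type) (L : complex S) (K : complex T) :
    \bar int :=
  least_positive (fun k => exists Ls : 'I_k -> complex S,
    [/\ forall i, subcomplex (Ls i) L, is_union L Ls &
        forall i, exists f : vertices (Ls i) -> vertices K,
          facet_simplicial_map f]).

Definition injective_facet_complexity (S T : Type)
    (L : complex S) (K : complex T) : \bar int :=
  least_positive (fun k => exists Ls : 'I_k -> complex S,
    [/\ forall i, subcomplex (Ls i) L, is_union L Ls &
        forall i, exists f : vertices (Ls i) -> vertices K,
          injective_facet_simplicial_map f]).

(* Main.v *)
Require Import Defs.
From mathcomp Require Import all_boot all_order all_algebra.
From mathcomp Require Import boolp classical_sets constructive_ereal.

(** Given facet simplicial maps [f : L_i -> H] and [g : H_j -> K], the preimage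
    of [H_j] under [f] may have facets that are not facets of [L_i], on which
    [g \o f] need not be facet simplicial.  We use instead the subcomplex
    [L_ij] of the simplices [F] of [L_i] contained in some simplex [G] of [L_i]
    all of whose extensions in [L_i] are mapped into [H_j].  A facet of [L_ij]
    is then a facet of [L_i], whose image is a facet of [H] lying in [H_j].
    For fixed [i] the [L_ij] cover [L_i], even if some simplices are not
    contained in any facet: the set of the [j] with [f G] in [H_j] decreases
    when [G] grows, so above [F] it is minimal, hence constant from there on,
    at some [G]. *)

Set Implicit Arguments.
Unset Strict Implicit.
Unset Printing Implicit Defensive.

Import Order.TTheory GRing.Theory Num.Theory.

Local Open Scope classical_set_scope.

(** Both minima are positive, so a product with an infinite factor is [+oo] and the convention
    [0 * +oo = 0] never interferes. When both are finite, their product is a positive candidate for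
    [R]. *)
Lemma least_positive_mul (P Q R : nat -> Prop) :
  (forall k l, P k -> Q l -> R (k * l)%N) ->
  (least_positive R <= least_positive P * least_positive Q)%E.
Proof.
move=> PQR; rewrite /least_positive.
case: (pselect (exists k, `[< (0 < k)%N /\ P k >])) => [exP|_]; last first.
  case: (pselect (exists k, `[< (0 < k)%N /\ Q k >])) => [exQ|_]; last first.
    by rewrite mulyy leey.
  case: ex_minnP => l /asboolP[l0 _] _.
  by rewrite gt0_mulye ?leey// lte_fin ltz_nat.
case: ex_minnP => k /asboolP[k0 Pk] _.
case: (pselect (exists k, `[< (0 < k)%N /\ Q k >])) => [exQ|_]; last first.
  by rewrite gt0_muley ?leey// lte_fin ltz_nat.
case: ex_minnP => l /asboolP[l0 Ql] _.
have Rkl : `[< (0 < k * l)%N /\ R (k * l)%N >].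
  by apply/asboolP; split; [rewrite muln_gt0 k0|exact: PQR].
case: pselect => [exR|[]]; last by exists (k * l)%N.
case: ex_minnP => m _ /(_ _ Rkl) mkl.
by rewrite -EFinM lee_fin -PoszM lez_nat.
Qed.

(** Common form of the predicates minimised in both complexities: [P] says that a piece has a map of
    the required kind. *)
Definition has_cover (T : Type) (P : complex T -> Prop) (L : complex T)
    (k : nat) : Prop :=
  exists Ls : 'I_k -> complex T,
    [/\ forall i, subcomplex (Ls i) L, is_union L Ls & forall i, P (Ls i)].

Lemma has_cover_trans (T : Type) (P R : complex T -> Prop) (L : complex T)
    (k l : nat) :
  (forall M, P M -> has_cover R M l) -> has_cover P L k ->
  has_cover R L (k * l).
Proof.
move=> PR [Ls [LsL LE PLs]].
have [Ms MsP] := choice (fun i => PR _ (PLs i)).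
have cardE : #|{: 'I_k * 'I_l}| = (k * l)%N by rewrite card_prod !card_ord.
pose dec (n : 'I_(k * l)) : 'I_k * 'I_l := enum_val (cast_ord (esym cardE) n).
have MsL n : subcomplex (Ms (dec n).1 (dec n).2) L.
  by have [sub _ _] := MsP (dec n).1; move=> F /sub /LsL.
exists (fun n => Ms (dec n).1 (dec n).2); split=> [//||n].
  apply/seteqP; split=> [F|F [n _] /MsL //].
  rewrite LE => -[i _]; have [_ -> _] := MsP i => -[j _ MijF].
  exists (cast_ord cardE (enum_rank (i, j))) => //.
  by rewrite /dec cast_ordK enum_rankK.
by have [_ _] := MsP (dec n).1; apply.
Qed.

Lemma facet_subcomplex (T : Type) (L K : complex T) (F : set T) :
  subcomplex L K -> simplices L F -> nonunitary_facet K F ->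
  nonunitary_facet L F.
Proof.
by move=> LK LF [[KF Fmax] nuF]; split=> //; split=> // G /LK; exact: Fmax.
Qed.

Lemma simplex_imageS (S T : Type) (L : complex S) (K : complex T)
    (f : vertices L -> vertices K) (F G : set S) :
  F `<=` G -> simplex_image f F `<=` simplex_image f G.
Proof. by move=> FG _ [x Fx <-]; exists x => //; exact: FG. Qed.

Section StablePreimage.
Variables (S T : Type) (L : complex S) (H : complex T).
Variable f : vertices L -> vertices H.
Hypothesis f_simp : simplicial_map f.

Definition stable_in (H' : complex T) (G : set S) : Prop :=
  simplices L G /\ forall G', simplices L G' -> G `<=` G' ->
    simplices H' (simplex_image f G').

Lemma stable_down (H' : complex T) (F G : set S) :
  (exists2 G', stable_in H' G' & F `<=` G') -> G `<=` F ->
  exists2 G', stable_in H' G' & G `<=` G'.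
Proof. by move=> [G' stG' FG'] GF; exists G' => //; apply: subset_trans FG'. Qed.

Definition stable_preimage (H' : complex T) : complex S :=
  Complex (@stable_down H').

Lemma stable_preimage_sub (H' : complex T) : subcomplex (stable_preimage H') L.
Proof. by move=> F [G [LG _]]; exact: simplices_down. Qed.

Lemma stable_preimage_image (H' : complex T) (F : set S) :
  simplices (stable_preimage H') F -> simplices H' (simplex_image f F).
Proof.
move=> [G [LG stG] FG].
exact: simplices_down (stG G LG (@subset_refl _ _)) (simplex_imageS FG).
Qed.

(** Maximality forces [F] to equal its stable witness [G]. Stability passes to every larger simplex
    of [L], so such a simplex is again in the preimage and cannot properly contain [F]. *)
Lemma stable_preimage_facet (H' : complex T) (F : set S) :
  nonunitary_facet (stable_preimage H') F -> nonunitary_facet L F.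
Proof.
move=> [[[G stG FG] Fmax] nuF]; split=> //.
have GF : G = F by apply: Fmax => //; exists G.
move: stG; rewrite GF => -[LF stF]; split=> // G' LG' FG'.
apply: Fmax => //; exists G' => //; split=> // G'' LG'' G'G''.
by apply: stF => //; exact: subset_trans G'G''.
Qed.

Lemma stable_preimage_union (J : finType) (Hs : J -> complex T) :
  is_union H Hs -> is_union L (fun j => stable_preimage (Hs j)).
Proof.
move=> HE; apply/seteqP; split=> [F LF|F [j _]]; last exact: stable_preimage_sub.
pose C G := [set j | `[< simplices (Hs j) (simplex_image f G) >]]%SET.
(* As [J] is finite, [C G] can be minimised through its cardinal. *)
have exC : exists n, `[< exists G, [/\ simplices L G, F `<=` G & #|C G| = n] >].
  by exists #|C F|; apply/asboolP; exists F; split=> // ?.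
case: (ex_minnP exC) => _ /asboolP[G [LG FG <-]] Cmin.
have := f_simp LG; rewrite HE => -[j _ HjG].
exists j => //; exists G => //; split=> // G' LG' GG'.
have CG'G : C G' \subset C G.
  apply/fintype.subsetP => i; rewrite !finset.inE => /asboolP HiG'; apply/asboolP.
  exact: simplices_down HiG' (simplex_imageS GG').
(* [G'] also contains [F], so by minimality its index set, a subset of [C G], has at least as many
   elements. *)
have CE : C G' = C G.
  apply/eqP; rewrite eqEcard CG'G; apply: Cmin; apply/asboolP; exists G'.
  by split=> //; exact: subset_trans GG'.
have : j \in C G' by rewrite CE finset.inE; apply/asboolP.
by rewrite finset.inE => /asboolP.
Qed.

Lemma stable_preimage_vertexL (H' : complex T)
    (x : vertices (stable_preimage H')) : val x \in vertices L.
Proof.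
have [F F_st Fx] := set_mem (valP x).
by apply/mem_set; exists F => //; exact: stable_preimage_sub F_st.
Qed.

Definition stable_incl (H' : complex T) (x : vertices (stable_preimage H')) :
  vertices L := exist _ (val x) (stable_preimage_vertexL x).

Lemma stable_preimage_vertexH (H' : complex T)
    (x : vertices (stable_preimage H')) :
  val (f (stable_incl x)) \in vertices H'.
Proof.
have [F F_st Fx] := set_mem (valP x).
apply/mem_set; exists (simplex_image f F); first exact: stable_preimage_image.
by exists (stable_incl x).
Qed.

(** The codomain shrinks too, so that a map defined only on [vertices H'] can be composed after
    it. *)
Definition stable_restr (H' : complex T) (x : vertices (stable_preimage H')) :
  vertices H' := exist _ (val (f (stable_incl x))) (stable_preimage_vertexH x).

Lemma stable_restr_image (H' : complex T) (F : set S) :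
  simplices (stable_preimage H') F ->
  simplex_image (@stable_restr H') F = simplex_image f F.
Proof.
move=> F_st; apply/seteqP; split=> [_ [x Fx <-]|_ [x Fx <-]].
  by exists (stable_incl x).
have xV : val x \in vertices (stable_preimage H') by apply/mem_set; exists F.
exists (exist _ (val x) xV) => //=.
(* The two vertices of [L] differ only in their membership proofs. *)
by congr (val (f _)); exact: val_inj.
Qed.

Lemma stable_restr_inj (H' : complex T) :
  injective f -> injective (@stable_restr H').
Proof.
move=> f_inj x y /(congr1 val) /= /val_inj /f_inj /(congr1 val) /= xy.
exact: val_inj.
Qed.

(** A facet of the preimage is one of [L], so [f] sends it to a facet of [H]; its image lies in
    [H'], where it stays maximal among fewer simplices. *)
Lemma stable_restr_facet (H' : complex T) :
  subcomplex H' H -> facet_simplicial_map f ->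
  facet_simplicial_map (@stable_restr H').
Proof.
move=> H'H [_ f_facet]; split=> [F F_st|F F_facet].
  by rewrite stable_restr_image//; exact: stable_preimage_image.
have F_st : simplices (stable_preimage H') F by case: F_facet => -[].
rewrite stable_restr_image//; apply: facet_subcomplex H'H _ _.
  exact: stable_preimage_image.
exact/f_facet/(@stable_preimage_facet H').
Qed.

End StablePreimage.

Lemma simplex_image_comp (S T U : Type) (L : complex S) (H : complex T)
    (K : complex U) (f : vertices L -> vertices H) (g : vertices H -> vertices K)
    (F : set S) :
  simplex_image (g \o f) F = simplex_image g (simplex_image f F).
Proof.
apply/seteqP; split=> [_ [x Fx <-]|_ [y [x Fx /val_inj <-] <-]].
  by exists (f x) => //; exists x.
by exists x.
Qed.

Lemma facet_simplicial_map_comp (S T U : Type) (L : complex S) (H : complex T)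
    (K : complex U) (f : vertices L -> vertices H)
    (g : vertices H -> vertices K) :
  facet_simplicial_map f -> facet_simplicial_map g ->
  facet_simplicial_map (g \o f).
Proof.
move=> [f_simp f_facet] [g_simp g_facet]; split=> F.
  by rewrite simplex_image_comp => /f_simp /g_simp.
by rewrite simplex_image_comp => /f_facet /g_facet.
Qed.

Theorem theorem3p7 (TL TH TK : Type)
    (L : complex TL) (H : complex TH) (K : complex TK) :
  (facet_complexity L K <= facet_complexity L H * facet_complexity H K)%E /\
  (injective_facet_complexity L K <=
     injective_facet_complexity L H * injective_facet_complexity H K)%E.
Proof.
split; apply: least_positive_mul => k l LH [Hs [HsH HE Hsg]].
  (* Each of the [k] pieces [M] of [L] is cut into the [l] stable preimages of the pieces of [H]. *)
  apply: (@has_cover_trans _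
    (fun M => exists f : vertices M -> vertices H, facet_simplicial_map f)
    (fun M => exists f : vertices M -> vertices K, facet_simplicial_map f)
    L k l _ LH) => M [f f_facet]; have f_simp := f_facet.1.
  exists (fun j => stable_preimage f (Hs j)); split=> [j||j].
  - exact: stable_preimage_sub.
  - exact: stable_preimage_union.
  have [g g_facet] := Hsg j; exists (g \o @stable_restr _ _ _ _ f (Hs j)).
  by apply: facet_simplicial_map_comp => //; exact: stable_restr_facet.
apply: (@has_cover_trans _
  (fun M => exists f : vertices M -> vertices H, injective_facet_simplicial_map f)
  (fun M => exists f : vertices M -> vertices K, injective_facet_simplicial_map f)
  L k l _ LH) => M [f [f_facet f_inj]]; have f_simp := f_facet.1.
exists (fun j => stable_preimage f (Hs j)); split=> [j||j].
- exact: stable_preimage_sub.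
- exact: stable_preimage_union.
have [g [g_facet g_inj]] := Hsg j.
exists (g \o @stable_restr _ _ _ _ f (Hs j)); split.
  by apply: facet_simplicial_map_comp => //; exact: stable_restr_facet.
by apply: inj_comp => //; exact: stable_restr_inj.
Qed.
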